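(* Let $X,Y$ be real Banach spaces, $A\subseteq X$ a nonempty closed convex set, $C\subseteq Y$ a closed convex cone with nonempty interior, and $F:X\to Y$ a continuous linear map with $F(X)\cap\operatorname{int}C\neq\emptyset$. Let $\theta$ be the associated merit function, assumed to satisfy $\theta(x)<+\infty$ for all $x\in X$. Then: (i) $\theta$ is concave on $X$; (ii) $\theta$ is Lipschitz continuous on $X$ with constant $\|F\|$.
   Context: For a nonempty set $D\subseteq Y$, $d_D(y)=\inf_{u\in D}\|y-u\|$, with $d_\emptyset\equiv+\infty$. The oriented distance function of $D\subseteq Y$ is $\Delta_D(y)=d_D(y)-d_{Y\setminus D}(y)$, with the conventions $\Delta_\emptyset\equiv+\infty$ and $\Delta_Y\equiv-\infty$. Write $C^+=\{y^*\in Y^*:\langle y^*,c\rangle\ge 0\ \forall c\in C\}$ and $S(C^+)=\{y^*\in C^+:\|y^*\|=1\}$. The merit function $\theta:X\to\mathbb{R}\cup\{+\infty\}$ is $$\theta(x)=\sup_{a\in A}\bigl(-\Delta_C(F(x)-F(a))\bigr)=\sup_{a\in A}\inf_{y^*\in S(C^+)}\langle y^*,F(x)-F(a)\rangle .$$ *)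

(* Defs.v *)
From HB Require Import structures.
From mathcomp Require Import all_boot all_order all_algebra.
From mathcomp Require Import all_classical all_reals all_analysis.

Set Implicit Arguments.
Unset Strict Implicit.
Unset Printing Implicit Defensive.

Import Order.TTheory GRing.Theory Num.Theory.
Import numFieldNormedType.Exports.

Local Open Scope classical_set_scope.
Local Open Scope ring_scope.
Local Open Scope convex_scope.

(* [ereal_inf set0 = +oo], so the distance to the empty set is +oo. *)
Definition set_dist (R : realType) (Y : normedModType R) (D : set Y) (y : Y)
    : \bar R :=
  ereal_inf [set (`|y - u|)%:E | u in D].

Definition oriented_dist (R : realType) (Y : normedModType R) (D : set Y)
    (y : Y) : \bar R :=
  (set_dist D y - set_dist (~` D) y)%E.

Definition merit (R : realType) (X Y : normedModType R) (A : set X)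
    (C : set Y) (F : X -> Y) (x : X) : \bar R :=
  ereal_sup [set (- oriented_dist C (F x - F a)%R)%E | a in A].

(* Scaling by t > 0 or by t >= 0 is the same thing for a nonempty closed set. *)
Definition convex_cone (R : realType) (Y : normedModType R) (C : set Y) :=
  convex_set C /\ forall (t : R) (c : Y), 0 < t -> C c -> C (t *: c).

(* The supremum is a genuine one when F is linear and continuous; the real
   [sup] of an unbounded set would be 0. *)
Definition opnorm (R : realType) (X Y : normedModType R) (F : X -> Y) : R :=
  sup [set `|F x| | x in [set x : X | `|x| <= 1]].

(* Same conventions as [convex_function], with the inequality reversed. *)
Definition concave_function (R : numFieldType) (E : lmodType R)
    (E' := convex_lmodType E) (D : set E') (f : E' -> R^o) :=
  forall (t : {i01 R}), {in D &, forall (x y : E'),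
    f x <| t |> f y <= f (x <| t |> y)}.

Section conventions.
Context {R : realType} {Y : normedModType R}.

Let set_distT (y : Y) : set_dist setT y = 0%E.
Proof.
apply/eqP; rewrite eq_le; apply/andP; split.
  by apply: ereal_inf_lbound; exists y => //; rewrite subrr normr0.
by apply: le_ereal_inf_tmp => _ [u _ <-]; rewrite lee_fin.
Qed.

Let set_dist0 (y : Y) : set_dist set0 y = +oo%E.
Proof. by rewrite /set_dist image_set0 ereal_inf0. Qed.

Lemma oriented_dist0 (y : Y) : oriented_dist set0 y = +oo%E.
Proof. by rewrite /oriented_dist setC0 set_dist0 set_distT. Qed.

Lemma oriented_distT (y : Y) : oriented_dist setT y = -oo%E.
Proof. by rewrite /oriented_dist setCT set_dist0 set_distT. Qed.

End conventions.

(* Main.v *)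
(* For a proper convex cone C the oriented distance is real-valued, positively
   homogeneous and subadditive, and it is bounded above by the norm; hence it
   is convex and 1-Lipschitz. Thus theta is a supremum over the convex set A of
   (x, a) |-> - Delta_C (F x - F a), which is jointly concave and, in x,
   ||F||-Lipschitz. Properness of C comes from the finiteness of theta, since
   Delta_Y = -oo. *)

Require Import Defs.
From HB Require Import structures.
From mathcomp Require Import all_boot all_order all_algebra.
From mathcomp Require Import all_classical all_reals all_analysis.
From mathcomp Require Import lra.

Import Order.TTheory GRing.Theory Num.Theory.
Import numFieldNormedType.Exports.

Local Open Scope classical_set_scope.
Local Open Scope ring_scope.

(** * Real-valued distance to a nonempty set *)

Section distance.
Local Set Implicit Arguments.
Local Unset Strict Implicit.
Context {R : realType} {Y : normedModType R}.
Implicit Types (D : set Y) (x y : Y).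

Definition dist D y : R := inf [set `|y - u| | u in D].

Lemma has_lbound_dist D y : has_lbound [set `|y - u| | u in D].
Proof. by exists 0 => _ [u _ <-]. Qed.

Lemma set_distE D y : D !=set0 -> set_dist D y = (dist D y)%:E.
Proof.
move=> [u Du]; rewrite /set_dist -ereal_inf_EFin.
- by rewrite image_comp.
- exact: has_lbound_dist.
- by exists `|y - u|, u.
Qed.

Lemma dist_le D y u : D u -> dist D y <= `|y - u|.
Proof. by move=> Du; apply: ge_inf; [exact: has_lbound_dist|exists u]. Qed.

Lemma le_dist D y (r : R) : D !=set0 ->
  (forall u, D u -> r <= `|y - u|) -> r <= dist D y.
Proof.
move=> [u Du] h; apply: lb_le_inf; first by exists `|y - u|, u.
by move=> _ [v Dv <-]; exact: h.
Qed.

Lemma dist_ge0 D y : D !=set0 -> 0 <= dist D y.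
Proof. by move=> D0; exact: le_dist. Qed.

Lemma dist_mem D y : D y -> dist D y = 0.
Proof.
move=> Dy; apply/eqP; rewrite eq_le dist_ge0 ?andbT; last by exists y.
by rewrite (le_trans (dist_le _ Dy))// subrr normr0.
Qed.

(** One inequality holds for every positive factor; applied to [t^-1] at [t *: y] it gives the
    converse. *)
Lemma dist_scale D (t : R) y : D !=set0 -> 0 < t ->
  (forall s u, 0 < s -> D u -> D (s *: u)) ->
  dist D (t *: y) = t * dist D y.
Proof.
move=> D0 t0 DZ.
have le_scale s z : 0 < s -> dist D (s *: z) <= s * dist D z.
  move=> s0; rewrite mulrC -ler_pdivrMr//; apply: le_dist => // u Du.
  rewrite ler_pdivrMr// mulrC -[X in X * _]gtr0_norm// -normrZ scalerBr.
  by apply: dist_le; exact: DZ.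
apply/eqP; rewrite eq_le le_scale//= mulrC -ler_pdivlMr// mulrC.
have := le_scale t^-1 (t *: y).
by rewrite scalerA mulVf ?gt_eqF// scale1r; apply; rewrite invr_gt0.
Qed.

Lemma mem_dist_setC D x v : `|v| < dist (~` D) x -> D (x + v).
Proof.
move=> vx; apply: contrapT => nD.
have := @dist_le (~` D) x (x + v) nD.
by rewrite opprD addrA subrr add0r normrN leNgt vx.
Qed.

(** Moving from [z] almost [r] towards the origin shortens the norm by that amount, and [d] still
    bounds what is left. This turns a ball of radius [r] inside a cone into an additive gain [r] in
    a distance estimate. *)
Lemma le_norm_shrink (z : Y) (r d : R) : r <= `|z| -> d <= `|z| ->
  (forall v, `|v| < r -> d <= `|z - v|) -> d + r <= `|z|.
Proof.
move=> rz dz h; apply/ler_addgt0Pr => e e0.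
have [re|er] := leP r e; first by lra.
have z0 : 0 < `|z| by lra.
(* [h] is applied to the multiple of [z] of norm [r - e]. *)
pose l := (r - e) / `|z|.
have l0 : 0 <= l by rewrite divr_ge0//; lra.
have l1 : l <= 1 by rewrite ler_pdivrMr//; lra.
have lz : l * `|z| = r - e by rewrite divfK ?gt_eqF.
have := h (l *: z); rewrite normrZ ger0_norm// lz.
rewrite -{1}[z]scale1r -scalerBl normrZ ger0_norm ?subr_ge0//.
by rewrite mulrBl mul1r lz; lra.
Qed.

End distance.

(** * Oriented distance of a proper convex cone *)

Section cone.
Local Set Implicit Arguments.
Local Unset Strict Implicit.
Context {R : realType} {Y : normedModType R} {C : set Y}.
Hypotheses (C_cone : convex_cone C) (C0 : C !=set0) (nC0 : ~` C !=set0).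
Implicit Types x y : Y.

(** The sum is twice the midpoint. *)
Lemma convex_coneD x y : C x -> C y -> C (x + y).
Proof.
case: C_cone => cC CZ Cx Cy.
have h0 : 0 <= 2^-1 :> R by rewrite invr_ge0.
have h1 : 2^-1 <= 1 :> R by rewrite invf_le1 ?ler1n.
have /set_mem Cm := cC _ _ (Itv01 h0 h1) (mem_set Cx) (mem_set Cy).
have := CZ 2 _ (ltr0Sn _ _) Cm.
have -> : conv (Itv01 h0 h1) (x : convex_lmodType Y) y = 2^-1 *: (x + y) :> Y.
  by rewrite scalerDr; congr (_ + _ *: _); change (1 - 2^-1 = 2^-1 :> R); lra.
by rewrite scalerA divff ?scale1r// pnatr_eq0.
Qed.

Definition odist y : R := dist C y - dist (~` C) y.

Lemma oriented_distE y : oriented_dist C y = (odist y)%:E.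
Proof. by rewrite /oriented_dist !set_distE. Qed.

Lemma odist_le_dist y : odist y <= dist C y.
Proof. by rewrite gerBl dist_ge0. Qed.

Lemma odist_scale (t : R) y : 0 < t -> odist (t *: y) = t * odist y.
Proof.
case: C_cone => _ CZ t0; rewrite mulrBr /odist !dist_scale// => s u s0 nCu Csu.
(* The complement is stable under positive scaling too: scale back by [s^-1]. *)
by apply: nCu; rewrite -[u]scale1r -(mulVf (lt0r_neq0 s0)) -scalerA;
  apply: CZ; rewrite ?invr_gt0.
Qed.

(** Small positive multiples of any [c] in [C] stay in [C] and tend to 0, so the distance to [C] is
    at most the distance to 0. *)
Lemma odist_le_norm y : odist y <= `|y|.
Proof.
apply: le_trans (odist_le_dist y) _; apply/ler_addgt0Pr => e e0.
have [c Cc] := C0; case: C_cone => _ CZ.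
have c1 : 0 < `|c| + 1 by rewrite ltr_wpDl.
have t0 : 0 < e / (`|c| + 1) by rewrite divr_gt0.
apply: le_trans (dist_le _ (CZ _ _ t0 Cc)) _.
apply: le_trans (ler_normB _ _) _; rewrite lerD2l normrZ gtr0_norm//.
by rewrite mulrAC ler_pdivrMr// ler_pM2l// lerDl.
Qed.

Lemma notin_coneB x y : ~ C x -> C y -> ~ C (x - y).
Proof. by move=> nCx Cy /convex_coneD-/(_ _ Cy); rewrite subrK. Qed.

Lemma distD x y : dist C (x + y) <= dist C x + dist C y.
Proof.
rewrite -lerBlDr; apply: le_dist => // u Cu.
rewrite lerBlDl -lerBlDr; apply: le_dist => // v Cv.
rewrite lerBlDl; apply: le_trans (dist_le _ (convex_coneD Cu Cv)) _.
by rewrite opprD addrACA ler_normD.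
Qed.

Lemma dist_setCD x y : C x -> C y ->
  dist (~` C) x + dist (~` C) y <= dist (~` C) (x + y).
Proof.
move=> Cx Cy; apply: le_dist => // u nCu.
rewrite addrC; apply: le_norm_shrink.
- have -> : x + y - u = x - (u - y) by rewrite opprB addrA.
  by apply: dist_le; exact: notin_coneB.
- have -> : x + y - u = y - (u - x) by rewrite opprB [x + y]addrC addrA.
  by apply: dist_le; exact: notin_coneB.
(* Here [x - v] is still in [C], so subtracting it from [u] stays outside [C]. *)
- move=> v vx.
  have -> : x + y - u - v = y - (u - (x - v)).
    by rewrite opprB [x + y]addrC -!addrA [- u - v]addrC.
  apply: dist_le; apply: notin_coneB => //.
  by apply: mem_dist_setC; rewrite normrN.
Qed.

Lemma odistD_mixed x y : C x -> ~ C y -> odist (x + y) <= odist x + odist y.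
Proof.
move=> Cx nCy.
rewrite /odist (dist_mem Cx) (@dist_mem _ _ (~` C) y)// sub0r subr0.
set r := dist (~` C) x.
have [Cxy|nCxy] := pselect (C (x + y)).
  rewrite (dist_mem Cxy); suff: r - dist C y <= dist (~` C) (x + y) by lra.
  apply: le_dist => // u nCu; suff: r - `|x + y - u| <= dist C y by lra.
  apply: le_dist => // c Cc; rewrite lerBlDl.
  (* The point [u - c] outside [C] bounds [r]; the triangle inequality then separates [u] from
     [c]. *)
  apply: le_trans (dist_le _ (notin_coneB nCu Cc)) _.
  have -> : x - (u - c) = (x + y - u) - (y - c).
    rewrite !opprB addrA [x + c]addrC [RHS]addrC addrA.
    by rewrite [x + y]addrC addrA subrK.
  exact: ler_normB.
rewrite (@dist_mem _ _ (~` C) (x + y))// subr0.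
suff: dist C (x + y) + r <= dist C y by lra.
(* Shrink [y - c]: for [v] of norm below [r], [x + v] is in [C], hence so is [x + v + c], which lies
   at distance [|y - c - v|] from [x + y]. *)
apply: le_dist => // c Cc; apply: le_norm_shrink.
- rewrite distrC; have -> : c - y = x - (x + y - c).
    by rewrite opprB addrCA opprD addNKr.
  by apply: dist_le; exact: notin_coneB.
- have -> : y - c = x + y - (x + c) by rewrite opprD addrACA subrr add0r.
  by apply: dist_le; exact: convex_coneD.
- move=> v vr; have -> : y - c - v = x + y - (x + v + c).
    by rewrite -[x + v + c]addrA opprD addrACA subrr add0r opprD addrA addrAC.
  by apply: dist_le; apply: convex_coneD => //; exact: mem_dist_setC.
Qed.

(** Split on membership in [C], which decides which of the two distances vanishes. *)
Lemma odistD x y : odist (x + y) <= odist x + odist y.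
Proof.
have [Cx|nCx] := pselect (C x); have [Cy|nCy] := pselect (C y).
- have Cxy := convex_coneD Cx Cy.
  rewrite /odist !(@dist_mem _ _ C)// !sub0r -opprD lerN2; exact: dist_setCD.
- exact: odistD_mixed.
- by rewrite addrC [X in _ <= X]addrC; exact: odistD_mixed.
- apply: le_trans (odist_le_dist _) _; apply: le_trans (distD _ _) _.
  by rewrite /odist !(@dist_mem _ _ (~` C))// !subr0.
Qed.

End cone.

(** Continuity bounds [F] on the unit ball, so the supremum in [opnorm] dominates the value at [x]
    divided by its norm. *)
Lemma opnorm_bound {R : realType} {X Y : normedModType R}
    (F : {linear X -> Y}) (x : X) :
  continuous F -> `|F x| <= opnorm F * `|x|.
Proof.
move=> F_cont.
have /linear_boundedP/pinfty_ex_gt0[M M0 FM] :=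
  continuous_linear_bounded 0 (F_cont 0).
have [->|x0] := eqVneq x 0; first by rewrite linear0 !normr0 mulr0.
have nx0 : 0 < `|x| by rewrite normr_gt0.
rewrite -ler_pdivrMr//; apply: ub_le_sup.
  exists M => _ [z /= z1 <-]; rewrite (le_trans (FM z))//.
  by rewrite ler_piMr// ltW.
exists (`|x|^-1 *: x) => /=.
  by rewrite normrZ gtr0_norm ?invr_gt0// mulVf ?gt_eqF.
by rewrite linearZ/= normrZ gtr0_norm ?invr_gt0// mulrC.
Qed.

Theorem theorem3p1 (R : realType) (X Y : completeNormedModType R)
    (A : set X) (C : set Y) (F : {linear X -> Y})
    (A_nonempty : A !=set0) (A_closed : closed A) (A_convex : convex_set A)
    (C_closed : closed C) (C_cone : convex_cone C) (C_int : C^° !=set0)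
    (F_cont : continuous F) (F_int : range F `&` C^° !=set0)
    (merit_lty : forall x : X, (merit A C F x < +oo)%E) :
  exists theta : X -> R^o,
    [/\ forall x : X, merit A C F x = (theta x)%:E,
        concave_function setT theta
      & (opnorm F).-lipschitz theta].
Proof.
have C0 : C !=set0 by have [c /interior_subset Cc] := C_int; exists c.
have nC0 : ~` C !=set0.
  apply/set0P/negP => /eqP nC; have [a Aa] := A_nonempty.
  have := merit_lty 0; rewrite ltNge => /negP; apply; apply: ereal_sup_ubound.
  exists a => //; have -> : C = setT by rewrite -[C]setCK nC setC0.
  by rewrite oriented_distT.
pose g x a := - odist (C := C) (F x - F a).
have meritE x : merit A C F x = ereal_sup [set (g x a)%:E | a in A].
  rewrite /merit; congr ereal_sup; apply: eq_imagel => a _.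
  by rewrite oriented_distE.
pose theta x : R := fine (merit A C F x).
have thetaE x : merit A C F x = (theta x)%:E.
  have [a Aa] := A_nonempty; rewrite fineK// fin_numElt merit_lty andbT.
  rewrite meritE; apply: (lt_le_trans (ltNyr (g x a))).
  by apply: ereal_sup_ubound; exists a.
have g_le x a : A a -> g x a <= theta x.
  move=> Aa; rewrite -lee_fin -thetaE meritE.
  by apply: ereal_sup_ubound; exists a.
have theta_le x (r : R) : (forall a, A a -> g x a <= r) -> theta x <= r.
  move=> gr; rewrite -lee_fin -thetaE meritE; apply: ge_ereal_sup.
  by move=> _ [a Aa <-]; rewrite lee_fin; exact: gr.
exists theta; split => //.
- move=> t x y _ _.
  change (t%:num * theta x + (1 - t%:num) * theta y <=
    theta (conv t (x : convex_lmodType X) y)).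
  (* The endpoints are set apart because both weights serve as divisors below. *)
  have [->|t0] := eqVneq t 0%:i01.
    by rewrite conv0/= mul0r add0r subr0 mul1r.
  have [->|t1] := eqVneq t 1%:i01.
    by rewrite conv1/= mul1r subrr mul0r addr0.
  have s0 : 0 < t%:num by rewrite lt_neqAle eq_sym t0 ge0.
  have s1 : 0 < 1 - t%:num by rewrite subr_gt0 lt_neqAle t1 le1.
  (* Isolating [theta x], then [theta y], lets [a] and [b] range over [A] independently; their
     convex combination is the competitor for [theta] at the combined point. *)
  rewrite -lerBrDr mulrC -ler_pdivlMr//; apply: (theta_le x) => a Aa.
  rewrite ler_pdivlMr// lerBrDr -lerBrDl [X in X <= _]mulrC -ler_pdivlMr//.
  apply: (theta_le y) => b Ab; rewrite ler_pdivlMr// lerBrDl.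
  have /set_mem Aab := A_convex _ _ t (mem_set Aa) (mem_set Ab).
  apply: le_trans (g_le _ _ Aab).
  rewrite /g !mulNr -opprD lerN2 mulrC [_ * (1 - _)]mulrC.
  have -> : F (conv t (x : convex_lmodType X) y) -
      F (conv t (a : convex_lmodType X) b) =
      t%:num *: (F x - F a) + (1 - t%:num) *: (F y - F b).
    change (F (t%:num *: (x : X) + (1 - t%:num) *: (y : X)) -
      F (t%:num *: a + (1 - t%:num) *: b) =
      t%:num *: (F x - F a) + (1 - t%:num) *: (F y - F b)).
    by rewrite !scalerBr !linearD/= !linearZ/= addrACA.
  by rewrite -!(odist_scale C_cone)//; exact: odistD.
- move=> [x y] _ /=.
  (* Subadditivity on [F v - F a = (F u - F a) + (F v - F u)] bounds [g u a] by [g v a] plus the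
     norm of [F v - F u]; exchanging [u] and [v] yields the absolute value. *)
  have half u v : theta u - theta v <= opnorm F * `|u - v|.
    rewrite distrC lerBlDl; apply: (theta_le u) => a Aa.
    have := odistD C_cone C0 nC0 (F u - F a) (F v - F u).
    have := odist_le_norm C_cone C0 nC0 (F v - F u).
    have := opnorm_bound F (v - u) F_cont.
    have := g_le v a Aa.
    rewrite linearB /g [F u - F a + _]addrC addrA subrK; lra.
  by rewrite ler_norml half andbT lerNl opprB distrC half.
Qed.
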